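(* Let $(R,\mathfrak{m})$ be a finite commutative local ring with identity $1\neq 0$ and maximal ideal $\mathfrak{m}\neq\{0\}$. (i) If $\mathfrak{m}^2=\{0\}$, then $\alpha(\Gamma(R))=1$. (ii) If $\mathfrak{m}^2\neq\{0\}$, then $2\leq \alpha(\Gamma(R))\leq |Z^*(R)|-|\mathrm{Ann}(Z(R))^*|$.
   Context: $Z(R)$ is the set of zero-divisors of $R$; for a subset $A\subseteq R$, $A^*=A\setminus\{0\}$; $\mathrm{Ann}(Z(R))=\{r\in R: rz=0 \text{ for all } z\in Z(R)\}$. $\Gamma(R)$ is the simple undirected graph with vertex set $Z^*(R)$, two distinct vertices $x,y$ adjacent iff $xy=0$. $\alpha(G)$ is the independence number of a graph $G$ (maximum size of a set of pairwise non-adjacent vertices). *)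

(* Defs.v *)
From mathcomp Require Import all_boot all_order all_fingroup all_algebra.

Set Implicit Arguments.
Unset Strict Implicit.
Unset Printing Implicit Defensive.

Import GRing.Theory.
Local Open Scope ring_scope.

(* [idealr_closed] includes properness: it requires 1 \notin I. *)
Definition maximal_ideal (R : finComNzRingType) (M : {set R}) : Prop :=
  idealr_closed M /\
  forall I : {set R}, idealr_closed I -> M \subset I -> I = M.

Definition local_ring (R : finComNzRingType) (M : {set R}) : Prop :=
  maximal_ideal M /\ forall I : {set R}, maximal_ideal I -> I = M.

(* <<_>> is taken in the additive group of R, so this is the set of finite     *)
(* sums of products u * v with u \in I and v \in J (see ideal_mulP).           *)
Definition ideal_mul (R : finComNzRingType) (I J : {set R}) : {set R} :=
  <<[set (u * v)%R | u in I, v in J]>>%g.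

Lemma ideal_mulP (R : finComNzRingType) (I J : {set R}) (x : R) :
  reflect (exists2 s : seq (R * R), all (fun p => (p.1 \in I) && (p.2 \in J)) s
             & x = \sum_(p <- s) p.1 * p.2)
          (x \in ideal_mul I J).
Proof.
apply: (iffP idP) => [|[s]].
- case/gen_prodgP => n [c c_in ->] {x}.
  elim: n c c_in => [|n IHn] c c_in.
    by exists [::] => //; rewrite big_ord0 big_nil.
  have [|s s_in es] := IHn (fun i => c (lift ord0 i)); first by move=> i.
  have /imset2P[u v uI vJ ec] := c_in ord0.
  exists ((u, v) :: s); first by rewrite /= uI vJ.
  by rewrite big_ord_recl big_cons es ec.
- elim: s x => [|[u v] s IHs] x /=; first by rewrite big_nil => _ ->; apply: group1.
  case/andP=> /andP[uI vJ] s_in ->; rewrite big_cons /=.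
  apply: (@groupM R <<_>>%G); last exact: IHs.
  by apply: mem_gen; apply: imset2_f.
Qed.

Definition zero_divisors (R : finComNzRingType) : {set R} :=
  [set x : R | [exists y : R, (y != 0) && (x * y == 0)]].

Definition annihilator (R : finComNzRingType) (A : {set R}) : {set R} :=
  [set r : R | [forall z in A, r * z == 0]].

Definition nonzero (R : finComNzRingType) (A : {set R}) : {set R} := A :\ 0.

Definition zd_vertex (R : finComNzRingType) : finType :=
  {x : R | x \in nonzero (zero_divisors R)}.

Definition zd_graph (R : finComNzRingType) : rel (zd_vertex R) :=
  fun x y => (x != y) && (val x * val y == 0).
Arguments zd_graph R : clear implicits.

Lemma zd_graph_sym (R : finComNzRingType) : symmetric (zd_graph R).
Proof. by move=> x y; rewrite /zd_graph eq_sym mulrC. Qed.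

Lemma zd_graph_irr (R : finComNzRingType) : irreflexive (zd_graph R).
Proof. by move=> x; rewrite /zd_graph eqxx. Qed.

Definition independent (T : finType) (e : rel T) (S : {set T}) : bool :=
  [forall x in S, forall y in S, (x != y) ==> ~~ e x y].

Definition independence_number (T : finType) (e : rel T) : nat :=
  \max_(S : {set T} | independent e S) #|S|.

(* Main.v *)
Require Import Defs.
From mathcomp Require Import all_boot all_order all_fingroup all_algebra.

(** In a finite ring every non-zero-divisor is a unit, so Z(R) = m for (R, m)
    local. If m^2 = 0 then the graph is complete. If u v <> 0 with u, v in m,
    then {u, v} is independent when u <> v, and {u, u + u^2} is when u = v,
    because u (u + u^2) = u^2 (1 + u) and 1 + u is not in m. Finally a nonzero
    element of Ann(Z(R)) is adjacent to every other vertex, hence lies in no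
    independent set with two elements or more. *)

Import GRing.Theory.
Local Open Scope ring_scope.

Section IndependentSets.
Variables (T : finType) (e : rel T).

Lemma leq_independence_number (S : {set T}) :
  independent e S -> (#|S| <= independence_number e)%N.
Proof. exact: (@leq_bigmax_cond _ _ (fun S : {set T} => #|S|)). Qed.

Lemma independentP (S : {set T}) :
  reflect {in S &, forall x y, x != y -> ~~ e x y} (independent e S).
Proof.
apply: (iffP forall_inP) => [indS x y xS yS|indS x xS].
  by move/forall_inP: (indS x xS) => /(_ y yS) /implyP.
by apply/forall_inP => y yS; apply/implyP; apply: indS.
Qed.

Lemma independent1 (x : T) : independent e [set x].
Proof. by apply/independentP=> y z /set1P-> /set1P->; rewrite eqxx. Qed.

Lemma independent2 (x y : T) :
  symmetric e -> ~~ e x y -> independent e [set x; y].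
Proof.
move=> e_sym nexy; apply/independentP=> u v.
by move=> /set2P[]-> /set2P[]->; rewrite ?eqxx // e_sym.
Qed.

Lemma independent_dominating (S : {set T}) (x : T) :
  independent e S -> x \in S -> (forall y, x != y -> e x y) -> S = [set x].
Proof.
move=> /independentP indS xS x_dom; apply/eqP.
rewrite eqEsubset sub1set xS andbT; apply/subsetP=> y yS; rewrite inE eq_sym.
by apply: contraT => neq_xy; move: (indS x y xS yS neq_xy); rewrite x_dom.
Qed.

End IndependentSets.

Section FiniteRing.
Variable R : finComNzRingType.
Implicit Types (x y : R) (I : {set R}).

Lemma zero_divisorsP x :
  reflect (exists2 y, y != 0 & x * y = 0) (x \in zero_divisors R).
Proof.
rewrite inE; apply: (iffP existsP) => -[y].
  by case/andP=> y0 /eqP xy0; exists y.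
by move=> y0 xy0; exists y; rewrite y0 xy0 eqxx.
Qed.

(** Multiplication by [x] has trivial kernel, so it is injective, hence bijective on a finite ring;
    the inverse of [x] is the preimage of 1. *)
Lemma non_zero_divisor_inv x :
  x \notin zero_divisors R -> exists y, x * y = 1.
Proof.
move=> nzd; suff /injF_bij[g _ gK] : injective ( *%R x) by exists (g 1).
move=> a b eq_ab; apply/eqP; rewrite -subr_eq0; apply: contraR nzd => ab0.
by apply/zero_divisorsP; exists (a - b); rewrite // mulrBr eq_ab subrr.
Qed.

(** A boolean form of [idealr_closed], since [maxset] takes a boolean predicate. *)
Let idealb I := [&& 0 \in I, 1 \notin I &
  [forall a, forall u in I, forall v in I, a * u + v \in I]].

Let idealbP I : reflect (idealr_closed I) (idealb I).
Proof.
apply: (iffP and3P) => [] [I0 I1 Icl]; split=> //.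
  move=> a u v uI vI.
  by have /forallP/(_ a)/forall_inP/(_ u uI)/forall_inP := Icl; apply.
by apply/forallP=> a; apply/forall_inP=> u uI; apply/forall_inP=> v; apply: Icl.
Qed.

Lemma ideal_sub_maximal I :
  idealr_closed I -> exists2 M, maximal_ideal M & I \subset M.
Proof.
move=> /idealbP/maxset_exists[M /maxsetP[/idealbP idM maxM] subIM].
exists M => //; split=> // J /idealbP idJ subMJ; exact: maxM.
Qed.

(** Properness is where the zero-divisor matters: if [x * z = 0] and [x * y = 1], then
    [z = x * y * z = 0]. *)
Lemma principal_idealr_closed x :
  x \in zero_divisors R -> idealr_closed [set x * y | y : R].
Proof.
move=> /zero_divisorsP[z z0 xz0]; split.
- by apply/imsetP; exists 0; rewrite ?mulr0.
- apply/imsetP=> -[y _ xy1]; case/eqP: z0.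
  by rewrite -[z]mul1r xy1 mulrAC xz0 mul0r.
- move=> a _ _ /imsetP[u _ ->] /imsetP[v _ ->].
  by apply/imsetP; exists (a * u + v); rewrite // mulrDr mulrCA.
Qed.

(** A zero-divisor generates a proper ideal, which lies in some maximal ideal, and [m] is the only
    one. Conversely, a non-zero-divisor in [m] would be a unit and put 1 in [m]. *)
Lemma local_zero_divisors (m : {set R}) :
  local_ring m -> zero_divisors R = m.
Proof.
move=> [[[m0 m1 m_cl] _] m_uniq]; apply/setP=> x; apply/idP/idP=> [zdx|xm].
  have [M /m_uniq-> /subsetP] := ideal_sub_maximal _ (principal_idealr_closed _ zdx).
  by apply; apply/imsetP; exists 1; rewrite ?mulr1.
apply: contraR m1 => /non_zero_divisor_inv[y <-].
by rewrite mulrC -[_ * _]addr0; apply: m_cl.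
Qed.

Lemma ideal_mul_eq0P (I J : {set R}) : 0 \in I -> 0 \in J ->
  reflect {in I & J, forall u v, u * v = 0} (ideal_mul I J == [set 0]).
Proof.
move=> I0 J0; apply: (iffP eqP) => [IJ0 u v uI vJ|IJ0].
  apply/set1P; rewrite -IJ0; apply/ideal_mulP; exists [:: (u, v)].
    by rewrite /= uI vJ.
  by rewrite big_seq1.
apply/setP=> x; rewrite inE; apply/ideal_mulP/eqP=> [[s /allP s_in ->]|->].
  by rewrite big_seq big1 // => p /s_in/andP[pI pJ]; apply: IJ0.
by exists [::]; rewrite ?big_nil.
Qed.

Lemma ideal_mul_selfP (I : {set R}) : idealr_closed I -> ideal_mul I I <> [set 0] ->
  exists u, exists2 v, (u \in I) && (v \in I) & u * v != 0.
Proof.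
move=> [I0 _ _] /eqP II0.
have [/existsP[u /existsP[v /andP[uvI uv0]]]|none] :=
  boolP [exists u, exists v, (u \in I) && (v \in I) && (u * v != 0)].
  by exists u, v.
case/negP: II0; apply/ideal_mul_eq0P=> // u v uI vI.
move: none => /existsPn/(_ u)/existsPn/(_ v).
by rewrite uI vI negbK => /eqP.
Qed.

Lemma local_nonzero_product (m : {set R}) :
  local_ring m -> ideal_mul m m <> [set 0] ->
  exists u v, [/\ u \in m, v \in m, u != v & u * v != 0].
Proof.
move=> Rm; have [[idm _] _] := Rm; have [m0 m1 m_cl] := idm.
move=> /(ideal_mul_selfP _ idm)[u [v /andP[um vm] uv0]].
have [eq_uv|] := eqVneq u v; last by exists u, v.
have u2_0 : u * u != 0 by rewrite {2}eq_uv.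
exists u, (u * u + u); split=> //.
- exact: m_cl.
(* The two elements differ by [u * u], which is nonzero. *)
- by rewrite eq_sym -subr_eq0 addrK.
- have -> : u * (u * u + u) = (1 + u) * (u * u).
    by rewrite mulrDl mul1r mulrDr addrC.
  apply: contraNneq m1 => u2_zd; have : 1 + u \in m.
    by rewrite -(local_zero_divisors _ Rm); apply/zero_divisorsP; exists (u * u).
  (* Writing 1 as [-1 * u + (1 + u)] gives it the shape [a * u + v] of the closure property. *)
  by move=> u1m; rewrite -(addrK u 1) addrC -mulN1r; apply: m_cl.
Qed.

(** Any nonzero [z] in Z(R) is killed by the whole annihilator. In a field no such [z] exists, and
    the annihilator of Z(R) = {0} is the whole ring. *)
Lemma nonzero_annihilator_sub :
  nonzero (zero_divisors R) != set0 ->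
  nonzero (annihilator (zero_divisors R)) \subset nonzero (zero_divisors R).
Proof.
case/set0Pn=> z /setD1P[z0 zZ]; apply: setSD; apply/subsetP=> a.
rewrite inE => /forall_inP/(_ z zZ)/eqP az0.
by apply/zero_divisorsP; exists z.
Qed.

Lemma annihilator_dominating (a b : zd_vertex R) :
  val a \in annihilator (zero_divisors R) -> a != b -> zd_graph R a b.
Proof.
rewrite inE => /forall_inP annA neq_ab.
by have /setD1P[_ bZ] := valP b; rewrite /zd_graph neq_ab annA.
Qed.

(** A member of [S] in the annihilator would dominate the graph and force [S] to be a singleton. So
    [S] embeds in [Z :\: A], whose size is the stated difference because [A \subset Z]. *)
Lemma independent_zd_le (S : {set zd_vertex R}) :
  independent (zd_graph R) S -> (1 < #|S|)%N ->
  (#|S| <= #|nonzero (zero_divisors R)|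
           - #|nonzero (annihilator (zero_divisors R))|)%N.
Proof.
move=> indS S_gt1; have [s sS] : exists s, s \in S.
  by apply/set0Pn; rewrite -card_gt0 ltnW.
rewrite -(card_imset _ val_inj).
set Z := nonzero _; set A := nonzero _.
have subAZ : A \subset Z.
  by apply: nonzero_annihilator_sub; apply/set0Pn; exists (val s); apply: valP.
rewrite -(setIidPr subAZ) -cardsD subset_leq_card //.
apply/subsetP=> _ /imsetP[x xS ->]; rewrite inE (valP x) andbT.
apply: contraTN S_gt1 => /setD1P[_ xA].
rewrite (independent_dominating _ _ _ _ indS xS) ?cards1 // => y.
exact: annihilator_dominating.
Qed.

End FiniteRing.

Theorem theorem14 (R : finComNzRingType) (m : {set R})
    (Rlocal : local_ring m) (m_neq0 : m <> [set 0]) :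
  (ideal_mul m m = [set 0] -> independence_number (zd_graph R) = 1%N) /\
  (ideal_mul m m <> [set 0] ->
     (2 <= independence_number (zd_graph R))%N /\
     (independence_number (zd_graph R) <=
        #|nonzero (zero_divisors R)|
        - #|nonzero (annihilator (zero_divisors R))|)%N).
Proof.
have Zm := local_zero_divisors _ _ Rlocal.
have [[[m0 _ _] _] _] := Rlocal.
have vertexP x : x \in m -> x != 0 -> x \in nonzero (zero_divisors R).
  by move=> xm x0; rewrite Zm !inE x0.
split=> [/eqP/ideal_mul_eq0P mm0|mm_neq0].
  have [x xm x0] : exists2 x, x \in m & x != 0.
    have: ~~ (m \subset [set 0]).
      apply: contra_notN m_neq0 => sub_m0.
      by apply/eqP; rewrite eqEsubset sub_m0 sub1set.
    by case/subsetPn=> x xm; rewrite inE; exists x.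
  pose vx : zd_vertex R := exist _ x (vertexP x xm x0).
  apply/eqP; rewrite eqn_leq; apply/andP; split; last first.
    by rewrite -(cards1 vx) leq_independence_number ?independent1.
  apply/bigmax_leqP=> S indS.
  have [->|[y yS]] := set_0Vmem S; first by rewrite cards0.
  (* As all products in [m] = Z(R) vanish, the vertex [y] lies in Ann(Z(R)) and so is adjacent to
     every other vertex. *)
  rewrite (independent_dominating _ _ _ _ indS yS) ?cards1 // => z.
  apply: annihilator_dominating; rewrite inE; apply/forall_inP=> w wZ.
  have /setD1P[_ yZ] := valP y.
  by rewrite mm0 // -Zm.
have [u [v [um vm neq_uv uv0]]] := local_nonzero_product _ _ Rlocal mm_neq0.
have u0 : u != 0 by apply: contraNneq uv0 => ->; rewrite mul0r.
have v0 : v != 0 by apply: contraNneq uv0 => ->; rewrite mulr0.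
pose vu : zd_vertex R := exist _ u (vertexP u um u0).
pose vv : zd_vertex R := exist _ v (vertexP v vm v0).
have alpha_ge2 : (2 <= independence_number (zd_graph R))%N.
  have <- : #|[set vu; vv]| = 2%N by rewrite cards2 -val_eqE neq_uv.
  apply: leq_independence_number; apply: independent2; first exact: zd_graph_sym.
  by rewrite /zd_graph (negPf uv0) andbF.
split=> //.
(* The upper bound holds for independent sets with at least two elements, so it is applied to one of
   maximum size, which has two by [alpha_ge2]. *)
have [|S indS alphaS] := @eq_bigmax_cond _ (independent (zd_graph R)) (fun S => #|S|).
  by apply/card_gt0P; exists [set vu]; apply: independent1.
rewrite /independence_number alphaS in alpha_ge2 *.
exact: independent_zd_le.
Qed.
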